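(* Consider the system on $\mathbb{R}^2$ $$\dot x_1=x_2,\qquad \dot x_2=-x_1-[1+b_2(t/\alpha)\,m(x,t)]\,x_2, \tag{P}$$ where $\alpha>0$ is a constant, and assume: - $m:\mathbb{R}^2\times\mathbb{R}\to[0,1]$ is Lipschitz continuous; - $b_2:\mathbb{R}\to(-\infty,0]$ is globally bounded and $C^1$ with bounded first derivative, and there are positive constants $T$ and $c_b$ such that $T+5\int_{t-T}^tb_2(l)\,dl\ge c_b$ for all $t\in\mathbb{R}$. Then, for each choice of the constant $\alpha>0$, the function $$V^\sharp_\alpha(x,t):=\exp\left(\frac{5\alpha}{T}\int_{\frac t\alpha-T}^{\frac t\alpha}\int_s^{\frac t\alpha}b_2(l)\,dl\,ds\right)(x_1^2+x_2^2+x_1x_2)$$ is a Lyapunov function for (P). Hence, (P) is UGAS for all constants $\alpha>0$.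
   Context: $|\cdot|$ is the Euclidean norm; subscripts on $W$ below denote partial gradients; $C^1$ means continuously differentiable. $\mathcal{K}_\infty$: continuous, strictly increasing, unbounded functions $\rho:[0,\infty)\to[0,\infty)$ with $\rho(0)=0$. $\mathcal{KL}$: continuous functions $\beta:[0,\infty)\times[0,\infty)\to[0,\infty)$ such that $\beta(\cdot,t)\in\mathcal{K}_\infty$ for each $t\ge0$, $\beta(s,\cdot)$ is non-increasing for each $s\ge0$, and $\beta(s,t)\to0$ as $t\to+\infty$ for each $s\ge 0$. A continuous function $\rho:[0,\infty)\to[0,\infty)$ is positive definite if it is zero only at zero. For a system $\dot x=h(x,t)$ on $\mathbb{R}^n$, $t\ge0$, with trajectories $\phi(t;t_o,x_o)$ (value $x_o$ at time $t_o$): - It is UGAS if there is $\beta\in\mathcal{KL}$ with $|\phi(t;t_o,x_o)|\le\beta(|x_o|,t-t_o)$ for all $x_o\in\mathbb{R}^n$, $t_o\ge0$, $t\ge t_o$. - A Lyapunov function for it is a $C^1$ function $W:\mathbb{R}^n\times[0,\infty)\to[0,\infty)$ for which there are $\alpha_1,\alpha_2\in\mathcal{K}_\infty$ and a positive definite $\alpha_3$ such that $\alpha_1(|x|)\le W(x,t)\le\alpha_2(|x|)$ and $W_t(x,t)+W_x(x,t)h(x,t)\le-\alpha_3(|x|)$ for all $t\ge0$, $x\in\mathbb{R}^n$. *)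

(* Defs.v *)
From Stdlib Require Export Reals.
From Coquelicot Require Export Coquelicot.
Open Scope R_scope.

(* Coquelicot's norm on a product is sqrt (norm _ ^ 2 + norm _ ^ 2), so on [R2]
   and on [R2 * R] it is the Euclidean norm of R^2 and of R^3. *)
Notation R2 := (R * R)%type.

(* Functions on [0, oo) are total functions on R of which only the values at
   nonnegative arguments matter. *)
Definition nonneg_half (r : R) : Prop := 0 <= r.

Definition class_Kinf (rho : R -> R) : Prop :=
  continuous_on nonneg_half rho /\
  (forall r, 0 <= r -> 0 <= rho r) /\
  (forall r s, 0 <= r -> r < s -> rho r < rho s) /\
  (forall M, exists r, 0 <= r /\ M < rho r) /\
  rho 0 = 0.

Definition class_KL (beta : R -> R -> R) : Prop :=
  continuous_on (fun p : R * R => 0 <= fst p /\ 0 <= snd p) (uncurry beta) /\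
  (forall s t, 0 <= s -> 0 <= t -> 0 <= beta s t) /\
  (forall t, 0 <= t -> class_Kinf (fun s => beta s t)) /\
  (forall s t t', 0 <= s -> 0 <= t -> t <= t' -> beta s t' <= beta s t) /\
  (forall s, 0 <= s -> is_lim (beta s) p_infty 0).

Definition positive_definite (rho : R -> R) : Prop :=
  continuous_on nonneg_half rho /\
  (forall r, 0 <= r -> 0 <= rho r) /\
  (forall r, 0 <= r -> (rho r = 0 <-> r = 0)).

(* Derivative of [f] at [t] relative to [D]; it is the one-sided derivative when
   [D] is an interval with end point [t]. *)
Definition is_derive_within {V : NormedModule R_AbsRing} (D : R -> Prop)
    (f : R -> V) (t : R) (l : V) : Prop :=
  filterdiff f (within D (locally t)) (fun y : R => scal y l).

(* [phi] solves x' = h(x,t) on [t0, t1), where [t1] may be +oo, and equals [x0]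
   at [t0]. *)
Definition is_trajectory (h : R2 -> R -> R2) (t0 : R) (x0 : R2) (t1 : Rbar)
    (phi : R -> R2) : Prop :=
  let D := fun t : R => t0 <= t /\ Rbar_lt t t1 in
  phi t0 = x0 /\
  forall t, D t -> is_derive_within D phi t (h (phi t) t).

(* The notation phi(t;t0,x0), t >= t0, presupposes that trajectories exist for
   all future times, so this is part of the definition; the estimate is required
   of every trajectory, including those given on a bounded interval only. *)
Definition UGAS (h : R2 -> R -> R2) : Prop :=
  exists beta, class_KL beta /\
  forall (x0 : R2) (t0 : R), 0 <= t0 ->
    (exists phi, is_trajectory h t0 x0 p_infty phi) /\
    (forall (t1 : Rbar) (phi : R -> R2), is_trajectory h t0 x0 t1 phi ->
       forall t : R, t0 <= t -> Rbar_lt t t1 ->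
         norm (phi t) <= beta (norm x0) (t - t0)).

(* [W] is C^1 on R^2 x [0, oo) with partial derivatives [W1], [W2] in the two
   space variables and [Wt] in time, the latter being one-sided at t = 0. *)
Definition is_C1_with_partials (W W1 W2 Wt : R2 -> R -> R) : Prop :=
  let D := fun p : R2 * R => 0 <= snd p in
  (forall x1 x2 t : R, 0 <= t ->
     is_derive (fun y => W (y, x2) t) x1 (W1 (x1, x2) t) /\
     is_derive (fun y => W (x1, y) t) x2 (W2 (x1, x2) t) /\
     is_derive_within nonneg_half (W (x1, x2)) t (Wt (x1, x2) t)) /\
  continuous_on D (uncurry W1) /\
  continuous_on D (uncurry W2) /\
  continuous_on D (uncurry Wt).

Definition is_Lyapunov_function (h : R2 -> R -> R2) (W : R2 -> R -> R) : Prop :=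
  (forall x t, 0 <= t -> 0 <= W x t) /\
  exists W1 W2 Wt : R2 -> R -> R,
    is_C1_with_partials W W1 W2 Wt /\
    exists alpha1 alpha2 alpha3 : R -> R,
      class_Kinf alpha1 /\ class_Kinf alpha2 /\ positive_definite alpha3 /\
      forall (x : R2) (t : R), 0 <= t ->
        alpha1 (norm x) <= W x t <= alpha2 (norm x) /\
        Wt x t + (W1 x t * fst (h x t) + W2 x t * snd (h x t))
          <= - alpha3 (norm x).

Definition lipschitz {U V : NormedModule R_AbsRing} (f : U -> V) : Prop :=
  exists L : R, forall u v, norm (minus (f u) (f v)) <= L * norm (minus u v).

Definition bounded_fun (f : R -> R) : Prop :=
  exists B : R, forall l, Rabs (f l) <= B.

Definition system_P (m : R2 -> R -> R) (b2 : R -> R) (alpha : R)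
    (x : R2) (t : R) : R2 :=
  (snd x, - fst x - (1 + b2 (t / alpha) * m x t) * snd x).

Definition V_sharp (b2 : R -> R) (T alpha : R) (x : R2) (t : R) : R :=
  exp (5 * alpha / T *
       RInt (fun s => RInt b2 s (t / alpha)) (t / alpha - T) (t / alpha))
  * (fst x ^ 2 + snd x ^ 2 + fst x * snd x).

(* Main.v *)
Require Import Defs.
From Stdlib Require Import Reals Lra Lia.
From Coquelicot Require Import Coquelicot.
Open Scope R_scope.

(* With Q = x1^2 + x2^2 + x1 x2 one has, along (P),
   Q' = - Q - b2 m (2 x2^2 + x1 x2) <= - (1 + 5 b2) Q, whatever the value of m in
   [0, 1].  The exponential weight of V_sharp has logarithmic derivative
   5 b2(t/alpha) - (5/T) int b2 over [t/alpha - T, t/alpha], so the b2 terms cancel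
   and excitation leaves V_sharp' <= - (cb/T) V_sharp.  As the weight lies between
   two positive constants, every trajectory decays exponentially.  Global
   trajectories come from Picard iteration for a cut-off field. *)

(** * Completeness of products *)

(** The rate [1 + 5 b2] may be negative at some times, so Q alone need not decrease. The logarithm
    of the weight acts as a corrector: its derivative replaces the pointwise value of [5 b2] by its
    mean over a window of length T, which is what the excitation hypothesis controls. The
    coefficient 5 bounds [2 x2^2 + x1 x2] by [5 Q]. The obstacle to global existence is the term
    [m x2]: although [m] is Lipschitz, the product is in general only locally Lipschitz. The
    estimate on Q holds for every coefficient with values in [0, 1], so the cut-off is placed inside
    [m]: the modified system then obeys the same decay bound with the same constants, and this bound
    shows that its trajectory never leaves the region where both systems agree. Trajectories may
    live on bounded intervals and have a one-sided derivative at the initial time, hence the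
    calculus of derivatives relative to a set. *)

Definition prod_CompleteSpace_lim {U V : CompleteSpace}
    (F : (U * V -> Prop) -> Prop) : U * V :=
  (lim (filtermap fst F), lim (filtermap snd F)).

(** A ball of the product is the product of two balls of the same radius, so both projections of a
    Cauchy filter are Cauchy and their limits can be paired. *)
Lemma prod_CompleteSpace_mixin (U V : CompleteSpace) :
  CompleteSpace.mixin_of (prod_UniformSpace U V).
Proof.
apply (CompleteSpace.Mixin (prod_UniformSpace U V) prod_CompleteSpace_lim).
- intros F FF HF eps.
  assert (H1 : cauchy (filtermap fst F)).
  { intros e; destruct (HF e) as [p Hp]; exists (fst p).
    exact (filter_imp (ball p e) _ (fun q Hq => proj1 Hq) Hp). }
  assert (H2 : cauchy (filtermap snd F)).
  { intros e; destruct (HF e) as [p Hp]; exists (snd p).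
    exact (filter_imp (ball p e) _ (fun q Hq => proj2 Hq) Hp). }
  assert (Q1 := complete_cauchy _ (filtermap_proper_filter _ _ fst F FF) H1 eps).
  assert (Q2 := complete_cauchy _ (filtermap_proper_filter _ _ snd F FF) H2 eps).
  exact (filter_and (F := F) _ _ Q1 Q2).
- intros F1 F2 H12 H21 eps; split; apply close_lim; intros P HP;
    first [apply H12 | apply H21]; exact HP.
Qed.

(** Built on the class of [prod_NormedModule], so that its norm on R * R is convertible to the
    Euclidean norm used for trajectories. It is the space in which [P_existence] runs the Picard
    iteration. *)
Definition prod_CompleteNormedModule (K : AbsRing)
    (U V : CompleteNormedModule K) : CompleteNormedModule K :=
  CompleteNormedModule.Pack K (U * V)
    (CompleteNormedModule.Class K (U * V)
       (NormedModule.class K (prod_NormedModule K U V))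
       (prod_CompleteSpace_mixin U V)) (U * V).

(** * Derivatives relative to a set *)

Section WithinDerivative.

Context {V : NormedModule R_AbsRing}.

(** Since [t] lies in [D], it belongs to every set of the filter, hence to every ball about [x].
    [filterdiff] quantifies over all limit points of its filter; this leaves [t] as the only one. *)
Lemma is_filter_lim_within (D : R -> Prop) (t x : R) :
  D t -> is_filter_lim (within D (locally t)) x -> x = t.
Proof.
intros Dt H.
destruct (Req_dec x t) as [|Hne]; [assumption|exfalso].
assert (He : 0 < Rabs (t - x)) by (apply Rabs_pos_lt; lra).
assert (Hl := H _ (locally_ball x (mkposreal _ He))).
assert (Hb := locally_singleton _ _ Hl Dt).
change (Rabs (t - x) < Rabs (t - x)) in Hb; lra.
Qed.

Lemma is_derive_within_iff (D : R -> Prop) (f : R -> V) (t : R) (l : V) :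
  D t ->
  is_derive_within D f t l <->
  forall eps : posreal, locally t (fun y => D y ->
    norm (minus (minus (f y) (f t)) (scal (y - t) l)) <= eps * Rabs (y - t)).
Proof.
intros Dt; split.
- intros [_ H] eps.
  apply (H t); intros P HP; unfold within.
  exact (filter_imp _ _ (fun x Hx _ => Hx) HP).
- intros H; split; [exact (is_linear_scal_l l)|].
  intros x Hx; rewrite (is_filter_lim_within D t x Dt Hx); exact H.
Qed.

(** One transfer principle for three uses: restricting the domain, dropping it at an interior point,
    and replacing the function by another one that agrees with it on the new domain near [t]. *)
Lemma is_derive_within_subset (D D' : R -> Prop) (f g : R -> V) (t : R) (l : V) :
  D t -> D' t -> locally t (fun y => D' y -> D y /\ f y = g y) ->
  is_derive_within D f t l -> is_derive_within D' g t l.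
Proof.
intros Dt D't HD Hf.
apply is_derive_within_iff; [assumption|intros eps].
destruct (locally_singleton _ _ HD D't) as [_ Et].
generalize (filter_and _ _ HD (proj1 (is_derive_within_iff D f t l Dt) Hf eps)).
apply filter_imp; intros y [H1 H2] Hy.
destruct (H1 Hy) as [Dy Ey]; rewrite <- Ey, <- Et; now apply H2.
Qed.

Lemma is_derive_within_full (f : R -> V) (t : R) (l : V) :
  is_derive_within (fun _ => True) f t l <-> is_derive f t l.
Proof.
split.
- intros H; split; [exact (is_linear_scal_l l)|].
  intros x Hx; rewrite <- (is_filter_lim_locally_unique t x Hx).
  intros eps; generalize (proj1 (is_derive_within_iff _ f t l I) H eps).
  apply filter_imp; intros y Hy; exact (Hy I).
- intros [_ H]; apply is_derive_within_iff; [easy|intros eps].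
  generalize (H t (fun P HP => HP) eps); apply filter_imp; intros y Hy _; exact Hy.
Qed.

Lemma is_derive_within_of_derive (D : R -> Prop) (f : R -> V) (t : R) (l : V) :
  D t -> is_derive f t l -> is_derive_within D f t l.
Proof.
intros Dt H; apply (is_derive_within_subset (fun _ => True) D f f); try easy.
- now apply filter_forall.
- now apply is_derive_within_full.
Qed.

Lemma is_derive_within_interior (D : R -> Prop) (f : R -> V) (t : R) (l : V) :
  locally t D -> is_derive_within D f t l -> is_derive f t l.
Proof.
intros HD H; apply is_derive_within_full.
assert (Dt := locally_singleton _ _ HD).
apply (is_derive_within_subset D (fun _ => True) f f); try easy.
exact (filter_imp _ _ (fun y Dy _ => conj Dy eq_refl) HD).
Qed.

End WithinDerivative.

(** * Picard iteration *)

Lemma continuous_Rmax_l (a t : R) : continuous (Rmax a) t.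
Proof.
apply filterlim_locally; intros eps; exists eps; intros s Hs.
change (Rabs (s - t) < eps) in Hs; change (Rabs (Rmax a s - Rmax a t) < eps).
revert Hs; unfold Rmax, Rabs.
destruct (Rle_dec a s), (Rle_dec a t), (Rcase_abs (s - t)); try lra;
  match goal with |- context [Rcase_abs ?z] => destruct (Rcase_abs z) end; lra.
Qed.

(** * Distances in normed modules *)

Lemma minus_plus_l {G : AbelianGroup} (x y z : G) :
  minus (plus x y) (plus x z) = minus y z.
Proof.
unfold minus; rewrite opp_plus, (plus_comm x y), <- plus_assoc, (plus_assoc x).
now rewrite plus_opp_r, plus_zero_l.
Qed.

Lemma minus_plus_cancel {G : AbelianGroup} (x y : G) : minus (plus x y) x = y.
Proof.
unfold minus; now rewrite plus_comm, plus_assoc, plus_opp_l, plus_zero_l.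
Qed.

Definition norm_dist {K : AbsRing} {V : NormedModule K} (x y : V) : R :=
  norm (minus x y).

Lemma norm_dist_diag {K : AbsRing} {V : NormedModule K} (x : V) :
  norm_dist x x = 0.
Proof. unfold norm_dist; rewrite minus_eq_zero; apply norm_zero. Qed.

Lemma norm_dist_eq_0 {K : AbsRing} {V : NormedModule K} (x y : V) :
  norm_dist x y = 0 -> x = y.
Proof.
intros H; apply norm_eq_zero in H.
assert (E : plus (minus x y) y = x)
  by (unfold minus; now rewrite <- plus_assoc, plus_opp_l, plus_zero_r).
rewrite <- E, H; apply plus_zero_l.
Qed.

Lemma norm_dist_triangle {K : AbsRing} {V : NormedModule K} (x y z : V) :
  norm_dist x z <= norm_dist x y + norm_dist y z.
Proof.
unfold norm_dist.
replace (minus x z) with (plus (minus x y) (minus y z)); [apply norm_triangle|].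
unfold minus; rewrite <- plus_assoc; f_equal.
now rewrite plus_assoc, plus_opp_l, plus_zero_l.
Qed.

Lemma norm_dist_sym {K : AbsRing} {V : NormedModule K} (x y : V) :
  norm_dist x y = norm_dist y x.
Proof. unfold norm_dist; rewrite <- norm_opp; now rewrite opp_minus. Qed.

Lemma half_pow_small (K eps : R) : 0 <= K -> 0 < eps -> exists n, K * (/ 2) ^ n < eps.
Proof.
intros HK Heps.
destruct (pow_lt_1_zero (/ 2) ltac:(rewrite Rabs_pos_eq; lra)
  (* Dividing by [K + 1] covers the case [K = 0]. *)
  (eps / (K + 1))) as [N HN].
{ apply Rdiv_lt_0_compat; lra. }
exists N; specialize (HN N (Nat.le_refl _)).
rewrite Rabs_pos_eq in HN by (apply pow_le; lra).
apply Rlt_div_r in HN; [|lra].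
assert (0 < (/ 2) ^ N) by (apply pow_lt; lra); lra.
Qed.

Section Picard.

Context {V : CompleteNormedModule R_AbsRing}.
Variables (f : V -> R -> V) (L M : R) (x0 : V) (t0 : R).
Hypothesis L_gt0 : 0 < L.
Hypothesis f_lipschitz : forall x y t,
  norm_dist (f x t) (f y t) <= L * norm_dist x y.
Hypothesis f_continuous : forall u : R -> V,
  (forall t, continuous u t) -> forall t, continuous (fun s => f (u s) s) t.
Hypothesis f_bound : forall t, norm (f x0 t) <= M.

(** Weight of a Bielecki norm: relative to [E], the integral operator contracts by 1/2 on the whole
    half-line, so global solutions arise without gluing local ones. *)
Let E (t : R) := exp (2 * L * (t - t0)).

(* Freezing the argument before [t0] makes every iterate continuous on all of R
   while only bounds forward in time are needed. *)
Let step (u : R -> V) (t : R) : V :=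
  plus x0 (RInt (fun s => f (u s) s) t0 (Rmax t0 t)).

Lemma is_RInt_field (u : R -> V) (a b : R) :
  (forall t, continuous u t) ->
  is_RInt (fun s => f (u s) s) a b (RInt (fun s => f (u s) s) a b).
Proof.
intros Hu; apply (RInt_correct (V := V)); apply ex_RInt_continuous; intros z _.
now apply f_continuous.
Qed.

Lemma is_derive_field_RInt (u : R -> V) (t : R) :
  (forall t, continuous u t) ->
  is_derive (fun t => plus x0 (RInt (fun s => f (u s) s) t0 t)) t (f (u t) t).
Proof.
intros Hu.
assert (HI : is_derive (fun t => RInt (fun s => f (u s) s) t0 t) t (f (u t) t)).
{ apply (is_derive_RInt (fun s => f (u s) s) _ t0).
  - apply filter_forall; intros b; now apply is_RInt_field.
  - now apply f_continuous. }
assert (H := is_derive_plus (V := V) _ _ t _ _ (is_derive_const x0 t) HI).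
rewrite plus_zero_l in H; exact H.
Qed.

Lemma step_continuous (u : R -> V) :
  (forall t, continuous u t) -> forall t, continuous (step u) t.
Proof.
intros Hu t.
apply (continuous_comp (Rmax t0)
  (fun t => plus x0 (RInt (fun s => f (u s) s) t0 t))).
- apply continuous_Rmax_l.
- apply (ex_derive_continuous (V := V)); eexists; now apply is_derive_field_RInt.
Qed.

(** The Lipschitz bound gives the integrand [L * A * E], whose primitive is [A / 2 * E]; the
    exponent [2 * L] in [E] is what produces the factor 1/2. *)
Lemma step_contract (u v : R -> V) (A : R) :
  (forall t, continuous u t) -> (forall t, continuous v t) -> 0 <= A ->
  (forall s, t0 <= s -> norm_dist (u s) (v s) <= A * E s) ->
  forall t, t0 <= t -> norm_dist (step u t) (step v t) <= A / 2 * E t.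
Proof.
intros Hu Hv HA Huv t Ht.
apply Rle_trans with (A / 2 * E t - A / 2 * E t0).
2: { assert (0 < E t0) by apply exp_pos; nra. }
unfold norm_dist, step; rewrite Rmax_right by assumption.
replace (minus _ _) with
  (minus (RInt (fun s => f (u s) s) t0 t) (RInt (fun s => f (v s) s) t0 t)).
2: symmetry; apply (minus_plus_l x0).
apply (norm_RInt_le (fun s => minus (f (u s) s) (f (v s) s))
  (fun s => L * (A * E s)) t0 t); [assumption| | |].
- intros s [Hs _]; apply Rle_trans with (1 := f_lipschitz _ _ _).
  apply Rmult_le_compat_l; [lra|]; now apply Huv.
- apply (is_RInt_minus (V := V)); now apply is_RInt_field.
- apply (is_RInt_derive (fun s => A / 2 * E s)).
  + intros s _; unfold E; auto_derive; [easy|]; unfold Rminus; field.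
  + intros s _; apply (ex_derive_continuous (fun s => L * (A * E s))).
    unfold E; auto_derive; easy.
Qed.

Fixpoint picard_iter (n : nat) : R -> V :=
  match n with O => fun _ => x0 | S n => step (picard_iter n) end.

Lemma picard_iter_continuous (n : nat) (t : R) : continuous (picard_iter n) t.
Proof.
revert t; induction n as [|n IHn]; simpl; intros t.
- apply continuous_const.
- now apply step_continuous.
Qed.

Lemma picard_iter_Rmax (n : nat) (t : R) :
  picard_iter n t = picard_iter n (Rmax t0 t).
Proof.
destruct n; [easy|]; simpl; unfold step.
now rewrite (Rmax_right t0 (Rmax t0 t)) by apply Rmax_l.
Qed.

(** Size of the first increment relative to [E]: it is at most
    [M * (t - t0) = C * (2 * L * (t - t0))], and z <= exp z. *)
Let C := M / (2 * L).

Lemma picard_C_ge0 : 0 <= C.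
Proof.
apply Rmult_le_pos; [|apply Rlt_le, Rinv_0_lt_compat; lra].
apply Rle_trans with (2 := f_bound t0), norm_ge_0.
Qed.

Lemma picard_iter_succ (n : nat) (t : R) : t0 <= t ->
  norm_dist (picard_iter (S n) t) (picard_iter n t) <= C * (/ 2) ^ n * E t.
Proof.
assert (HC := picard_C_ge0).
revert t; induction n as [|n IHn]; intros t Ht.
- simpl; unfold norm_dist, step; rewrite Rmax_right by assumption.
  replace (minus _ _) with (RInt (fun s => f x0 s) t0 t)
    by (symmetry; apply (minus_plus_cancel x0)).
  apply Rle_trans with ((t - t0) * M).
  + apply (norm_RInt_le_const (fun s => f x0 s)); [assumption|easy|].
    apply (is_RInt_field (fun _ => x0)); intros; apply continuous_const.
  + assert (HE : 2 * L * (t - t0) <= E t) by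
      (unfold E; assert (H := exp_ineq1_le (2 * L * (t - t0))); lra).
    apply Rle_trans with (C * (2 * L * (t - t0))).
    * unfold C; right; field; lra.
    * rewrite Rmult_1_r; now apply Rmult_le_compat_l.
- change (picard_iter (S (S n))) with (step (picard_iter (S n))).
  change (picard_iter (S n) t) with (step (picard_iter n) t).
  replace (C * (/ 2) ^ S n) with (C * (/ 2) ^ n / 2) by (simpl; field).
  apply step_contract; try apply picard_iter_continuous; try assumption.
  apply Rmult_le_pos; [assumption|apply pow_le; lra].
Qed.

Lemma picard_iter_cauchy (n k : nat) (t : R) : t0 <= t ->
  norm_dist (picard_iter (n + k) t) (picard_iter n t) <= 2 * C * (/ 2) ^ n * E t.
Proof.
intros Ht.
assert (HC := picard_C_ge0); assert (HE : 0 < E t) by apply exp_pos.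
assert (Hp : forall j, 0 < (/ 2) ^ j) by (intros; apply pow_lt; lra).
(* The exact partial sum of the geometric series is the form that passes through the induction on
   [k]. *)
enough (H : norm_dist (picard_iter (n + k) t) (picard_iter n t)
  <= 2 * C * ((/ 2) ^ n - (/ 2) ^ (n + k)) * E t).
{ apply Rle_trans with (1 := H), Rmult_le_compat_r; [lra|].
  apply Rmult_le_compat_l; [lra|]; specialize (Hp (n + k)%nat); lra. }
induction k as [|k IHk].
- rewrite Nat.add_0_r; apply Rle_trans with 0; [right; apply norm_dist_diag|lra].
- rewrite Nat.add_succ_r.
  apply Rle_trans with (1 := norm_dist_triangle _ (picard_iter (n + k) t) _).
  generalize (picard_iter_succ (n + k) t Ht); simpl pow; lra.
Qed.

(** [lim] is total, so the definition needs no convergence proof; [picard_limit] supplies it. Like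
    the iterates, the limit is frozen before [t0]. *)
Let phi (t : R) : V := lim (filtermap (fun n => picard_iter n (Rmax t0 t)) eventually).

Lemma picard_limit (n : nat) (t : R) :
  norm_dist (picard_iter n t) (phi t) <= 2 * C * (/ 2) ^ n * E (Rmax t0 t).
Proof.
rewrite picard_iter_Rmax; unfold phi.
set (r := Rmax t0 t); assert (Hr : t0 <= r) by apply Rmax_l.
set (F := filtermap _ _).
assert (HC := picard_C_ge0); assert (HE : 0 < E r) by apply exp_pos.
assert (FF : ProperFilter F) by
  (apply filtermap_proper_filter, eventually_filter).
assert (HF : cauchy F).
{ intros eps.
  destruct (half_pow_small (2 * C * E r) eps) as [N HN]; [nra|apply eps|].
  exists (picard_iter N r); exists N; intros m Hm.
  apply (norm_compat1 (V := V)).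
  replace m with (N + (m - N))%nat by lia.
  apply Rle_lt_trans with (1 := picard_iter_cauchy _ _ _ Hr).
  lra. }
apply le_epsilon; intros eps Heps.
(* Completeness speaks of [ball], which bounds the norm only up to the factor [c]; hence the radius
   [eps / c]. *)
set (c := @norm_factor R_AbsRing V).
assert (Hc : 0 < c) by apply norm_factor_gt_0.
assert (Hd : 0 < eps / c) by now apply Rdiv_lt_0_compat.
destruct (complete_cauchy F FF HF (mkposreal _ Hd)) as [N HN].
assert (Hb : norm_dist (picard_iter (n + N) r) (lim F) < c * (eps / c))
  by (apply (norm_compat2 (V := V) _ _ (mkposreal _ Hd)), HN; lia).
replace (c * (eps / c)) with eps in Hb by (field; lra).
apply Rle_trans with (1 := norm_dist_triangle _ (picard_iter (n + N) r) _).
rewrite (norm_dist_sym (picard_iter n r)).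
apply Rplus_le_compat; [now apply picard_iter_cauchy|now apply Rlt_le].
Qed.

(** Convergence is uniform up to time [t + 1], because [E] is monotone; the usual eps/3 argument
    follows. *)
Lemma picard_limit_continuous (t : R) : continuous phi t.
Proof.
apply (filterlim_locally_ball_norm (U := V)); intros eps.
assert (HC := picard_C_ge0).
assert (Hmon : forall s, s <= t + 1 -> E (Rmax t0 s) <= E (Rmax t0 (t + 1))).
{ intros s Hs; unfold E.
  assert (H : 2 * L * (Rmax t0 s - t0) <= 2 * L * (Rmax t0 (t + 1) - t0)).
  { apply Rmult_le_compat_l; [lra|].
    apply Rplus_le_compat_r; now apply Rle_max_compat_l. }
  destruct H as [H| ->]; [now left; apply exp_increasing|now right]. }
set (B := E (Rmax t0 (t + 1))) in Hmon.
assert (HB : 0 < B) by apply exp_pos.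
destruct (half_pow_small (2 * C * B) (eps / 3)) as [n Hn];
  [nra|apply Rdiv_lt_0_compat; [apply eps|lra]|].
assert (Hlim : forall s, s <= t + 1 ->
  norm_dist (picard_iter n s) (phi s) < eps / 3).
{ intros s Hs; apply Rle_lt_trans with (1 := picard_limit n s).
  assert (0 < (/ 2) ^ n) by (apply pow_lt; lra).
  apply Rle_lt_trans with (2 := Hn).
  replace (2 * C * B * (/ 2) ^ n) with (2 * C * (/ 2) ^ n * B) by ring.
  apply Rmult_le_compat_l; [nra|now apply Hmon]. }
assert (He3 : 0 < eps / 3) by (apply Rdiv_lt_0_compat; [apply eps|lra]).
generalize (filter_and _ _ (locally_ball t (mkposreal 1 Rlt_0_1))
  (proj1 (filterlim_locally_ball_norm (U := V) _ _)
     (picard_iter_continuous n t) (mkposreal _ He3))).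
apply filter_imp; intros s [Hs1 Hs2].
change (Rabs (s - t) < 1) in Hs1; apply Rabs_lt_between in Hs1.
change (norm_dist (picard_iter n s) (picard_iter n t) < eps / 3) in Hs2.
change (norm_dist (phi s) (phi t) < eps).
assert (H1 := Hlim s ltac:(lra)); assert (H2 := Hlim t ltac:(lra)).
rewrite norm_dist_sym in H1.
assert (H3 := norm_dist_triangle (phi s) (picard_iter n s) (phi t)).
assert (H4 := norm_dist_triangle (picard_iter n s) (picard_iter n t) (phi t)).
lra.
Qed.

(** Both sides lie within [C * (/ 2) ^ n * E t] of [picard_iter (S n) t]: the left one by the
    convergence rate, the right one by contraction. *)
Lemma picard_limit_fixed (t : R) : t0 <= t -> phi t = step phi t.
Proof.
intros Ht.
assert (HC := picard_C_ge0); assert (HE : 0 < E t) by apply exp_pos.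
assert (Hlim : forall n s, t0 <= s ->
  norm_dist (picard_iter n s) (phi s) <= 2 * C * (/ 2) ^ n * E s).
{ intros n s Hs; rewrite <- (Rmax_right t0 s) at 3 by assumption.
  apply picard_limit. }
enough (H : norm_dist (phi t) (step phi t) = 0).
{ now apply norm_dist_eq_0. }
apply Rle_antisym; [|apply norm_ge_0].
apply le_epsilon; intros eps Heps; rewrite Rplus_0_l.
destruct (half_pow_small (2 * C * E t) eps) as [n Hn]; [nra|easy|].
assert (Hp : 0 < (/ 2) ^ n) by (apply pow_lt; lra).
apply Rle_trans with (1 := norm_dist_triangle _ (picard_iter (S n) t) _).
rewrite norm_dist_sym.
assert (H1 := Hlim (S n) t Ht); simpl pow in H1.
assert (H2 := step_contract (picard_iter n) phi (2 * C * (/ 2) ^ n)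
  (picard_iter_continuous n) picard_limit_continuous ltac:(nra) (Hlim n) t Ht).
change (step (picard_iter n) t) with (picard_iter (S n) t) in H2.
lra.
Qed.

Lemma picard_existence : exists u : R -> V, u t0 = x0 /\
  forall t, t0 <= t ->
    is_derive_within (fun s => t0 <= s /\ Rbar_lt s p_infty) u t (f (u t) t).
Proof.
exists phi; split.
- rewrite picard_limit_fixed by lra; unfold step.
  rewrite Rmax_left by lra; now rewrite RInt_point, plus_zero_r.
- intros t Ht.
  (* Without [Rmax] the integral is differentiable on all of R and equals [phi] from [t0] on, so the
     one-sided derivative at [t0] needs no separate treatment. *)
  apply (is_derive_within_subset (fun _ => True) _
    (fun t => plus x0 (RInt (fun s => f (phi s) s) t0 t))); try easy.
  + apply filter_forall; intros s [Hs _]; split; [easy|].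
    rewrite picard_limit_fixed by assumption; unfold step.
    now rewrite Rmax_right.
  + apply is_derive_within_full, is_derive_field_RInt, picard_limit_continuous.
Qed.

End Picard.

(** * Comparison functions *)

Lemma exp_le_mono (x y : R) : x <= y -> exp x <= exp y.
Proof. intros [H| ->]; [left; now apply exp_increasing|now right]. Qed.

Lemma norm_R2_sqr (x : R2) : norm x ^ 2 = fst x ^ 2 + snd x ^ 2.
Proof.
change (norm x) with (sqrt (Rabs (fst x) ^ 2 + Rabs (snd x) ^ 2)).
rewrite pow2_sqrt, !pow2_abs; [easy|].
generalize (pow2_ge_0 (Rabs (fst x))), (pow2_ge_0 (Rabs (snd x))); lra.
Qed.

(** * The quadratic form of the Lyapunov function *)

Definition Q (x : R2) : R := fst x ^ 2 + snd x ^ 2 + fst x * snd x.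

Lemma Q_bounds (x : R2) : norm x ^ 2 / 2 <= Q x <= 3 / 2 * norm x ^ 2.
Proof.
rewrite norm_R2_sqr; unfold Q.
generalize (pow2_ge_0 (fst x + snd x)), (pow2_ge_0 (fst x - snd x)); nra.
Qed.

Lemma Q_ge0 (x : R2) : 0 <= Q x.
Proof. generalize (Q_bounds x), (pow2_ge_0 (norm x)); lra. Qed.

(** The left side equals [- Q x - b * mu * (2 x2^2 + x1 x2)]. As [- b >= 0], it remains to bound
    [mu * (2 x2^2 + x1 x2)] by [5 * Q x]. *)
Lemma Q_derivative_bound (x : R2) (b mu : R) : b <= 0 -> 0 <= mu <= 1 ->
  (2 * fst x + snd x) * snd x
  + (2 * snd x + fst x) * (- fst x - (1 + b * mu) * snd x)
  <= - (1 + 5 * b) * Q x.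
Proof.
destruct x as [x1 x2]; unfold Q; simpl; intros Hb Hmu.
assert (H : 0 <= 5 * (x1 ^ 2 + x2 ^ 2 + x1 * x2) - mu * (2 * x2 ^ 2 + x1 * x2)).
(* The expression is affine in [mu], hence a convex combination of its values at 0 and 1, both of
   them nonnegative quadratic forms. *)
{ replace (_ - _) with ((1 - mu) * (5 * (x1 ^ 2 + x2 ^ 2 + x1 * x2))
    + mu * (5 * x1 ^ 2 + 4 * (x1 * x2) + 3 * x2 ^ 2)) by ring.
  assert (0 <= x1 ^ 2 + x2 ^ 2 + x1 * x2) by nra.
  assert (0 <= 5 * x1 ^ 2 + 4 * (x1 * x2) + 3 * x2 ^ 2) by nra.
  apply Rplus_le_le_0_compat; apply Rmult_le_pos; lra. }
nra.
Qed.

(** * Quadratic and exponential comparison functions *)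

Lemma class_Kinf_scal_pow2 (k : R) : 0 < k -> class_Kinf (fun r => k * r ^ 2).
Proof.
intros Hk; split; [|split; [|split; [|split]]].
- apply continuous_on_forall; intros r _.
  apply (ex_derive_continuous (fun r => k * r ^ 2)); auto_derive; easy.
- intros r Hr; assert (0 <= r ^ 2) by apply pow2_ge_0; nra.
- intros r s Hr Hs; apply Rmult_lt_compat_l; [easy|nra].
(* The summand 1 gives [r ^ 2 >= r], so that [k * r ^ 2 >= k + Rabs M > M]. *)
- intros M; exists (1 + Rabs M / k).
  assert (0 <= Rabs M / k)
    by (apply Rmult_le_pos; [apply Rabs_pos|now apply Rlt_le, Rinv_0_lt_compat]).
  split; [lra|].
  assert (E : k * (Rabs M / k) = Rabs M) by (field; lra).
  assert (M <= Rabs M) by apply Rle_abs.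
  set (q := Rabs M / k) in *; nra.
- ring.
Qed.

Lemma class_Kinf_positive_definite (rho : R -> R) :
  class_Kinf rho -> positive_definite rho.
Proof.
intros (Hc & Hp & Hi & _ & H0); split; [easy|split; [easy|]].
intros r Hr; split; [|intros ->; easy].
intros Hz; destruct Hr as [Hr|]; [|easy].
assert (H := Hi 0 r (Rle_refl 0) Hr); lra.
Qed.

Lemma class_KL_exp (K c : R) : 0 < K -> 0 < c ->
  class_KL (fun s t => K * s * exp (- c * t)).
Proof.
intros HK Hc.
assert (Hexp : forall t, 0 < exp (- c * t)) by (intros; apply exp_pos).
split; [|split; [|split; [|split]]].
- apply continuous_on_forall; intros [s t] _.
  apply (continuous_ext (fun p => K * fst p * exp (- c * snd p)));
    [now intros []|].
  apply (continuous_mult (K := R_AbsRing) (fun p : R * R => K * fst p)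
    (fun p => exp (- c * snd p))).
  + apply (continuous_mult (K := R_AbsRing) (fun _ : R * R => K) fst);
      [apply continuous_const|apply continuous_fst].
  + apply continuous_comp; [|apply continuous_exp].
    apply (continuous_mult (K := R_AbsRing) (fun _ : R * R => - c) snd);
      [apply continuous_const|apply continuous_snd].
- intros s t Hs _; specialize (Hexp t).
  apply Rmult_le_pos; [apply Rmult_le_pos|]; lra.
- intros t Ht; specialize (Hexp t); split; [|split; [|split; [|split]]].
  + apply continuous_on_forall; intros r _.
    apply (ex_derive_continuous (fun s => K * s * exp (- c * t))); auto_derive; easy.
  + intros r Hr; apply Rmult_le_pos; [apply Rmult_le_pos|]; lra.
  + intros r s _ Hrs; apply Rmult_lt_compat_r; [easy|].
    now apply Rmult_lt_compat_l.
  + intros M; set (k := K * exp (- c * t)).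
    assert (Hk : 0 < k) by now apply Rmult_lt_0_compat.
    assert (Hq : 0 <= Rabs M / k)
      by (apply Rmult_le_pos; [apply Rabs_pos|now apply Rlt_le, Rinv_0_lt_compat]).
    exists (1 + Rabs M / k); split; [lra|].
    replace (K * _ * _) with (k + Rabs M) by (unfold k in *; field; lra).
    assert (HM := Rle_abs M); lra.
  + ring.
- intros s t t' Hs Ht Htt'; apply Rmult_le_compat_l; [apply Rmult_le_pos; lra|].
  destruct Htt' as [Htt'| ->]; [|now right].
  left; apply exp_increasing; nra.
- intros s Hs.
  replace (Finite 0) with (Rbar_mult (K * s) 0) by (simpl; f_equal; ring).
  apply is_lim_scal_l.
  apply (is_lim_comp exp (fun t => - c * t) p_infty 0 m_infty).
  + apply is_lim_exp_m.
  + replace m_infty with (Rbar_mult (- c) p_infty).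
    * apply is_lim_scal_l, is_lim_id.
    * simpl; destruct (Rle_dec 0 (- c)); [exfalso; lra|easy].
  + exists 0; intros; discriminate.
Qed.

(** * Trajectories *)

Section Trajectory.

Variables (h : R2 -> R -> R2) (t0 : R) (x0 : R2) (t1 : Rbar) (phi : R -> R2).
Hypothesis phi_trajectory : is_trajectory h t0 x0 t1 phi.

Lemma trajectory_is_derive (t : R) : t0 < t -> Rbar_lt t t1 ->
  is_derive (fun s => fst (phi s)) t (fst (h (phi t) t)) /\
  is_derive (fun s => snd (phi s)) t (snd (h (phi t) t)).
Proof.
intros H0 H1.
assert (H : is_derive phi t (h (phi t) t)).
{ destruct phi_trajectory as [_ Hphi].
  apply (is_derive_within_interior _ _ _ _) with (2 := Hphi t (conj (Rlt_le _ _ H0) H1)).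
  apply filter_and; [|now apply open_Rbar_lt].
  generalize (open_gt t0 t H0); apply filter_imp; intros; now apply Rlt_le. }
split.
- exact (filterdiff_comp phi fst _ fst H (filterdiff_linear fst is_linear_fst)).
- exact (filterdiff_comp phi snd _ snd H (filterdiff_linear snd is_linear_snd)).
Qed.

(** Freezing the trajectory before [t0] turns one-sided continuity at [t0] into the two-sided
    continuity that the mean value theorem asks for. *)
Lemma trajectory_continuous (t : R) : t0 <= t -> Rbar_lt t t1 ->
  continuous (fun s => phi (Rmax t0 s)) t.
Proof.
intros H0 H1; destruct phi_trajectory as [_ Hphi].
set (D := fun t : R => t0 <= t /\ Rbar_lt t t1).
assert (Dt : D t) by now split.
assert (Hl : filterlim phi (within D (locally t)) (locally (phi t))).
{ apply (filterdiff_continuous_aux (K := R_AbsRing)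
    (V := prod_NormedModule R_AbsRing R_NormedModule R_NormedModule) phi).
  - eexists; exact (Hphi t Dt).
  - intros P HP; exact (filter_imp _ _ (fun s Hs _ => Hs) HP). }
unfold continuous; rewrite (Rmax_right t0 t) by assumption.
apply filterlim_comp with (2 := Hl).
assert (Hm := continuous_Rmax_l t0 t); unfold continuous in Hm.
rewrite Rmax_right in Hm by assumption.
intros P HP.
change (locally t (fun s => P (Rmax t0 s))).
generalize (filter_and (F := locally t) _ _ (Hm _ HP) (Hm _ (open_Rbar_lt t1 t H1))).
apply filter_imp; intros s [Hs1 Hs2]; apply Hs1; split; [apply Rmax_l|exact Hs2].
Qed.

End Trajectory.

(** * The exponential weight *)

Section Weight.

Variables (b2 : R -> R) (T alpha B : R).
Hypothesis b2_continuous : forall l, continuous b2 l.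
Hypothesis b2_bound : forall l, Rabs (b2 l) <= B.
Hypothesis T_gt0 : 0 < T.
Hypothesis alpha_gt0 : 0 < alpha.

Lemma continuous_is_RInt (g : R -> R) (a c : R) :
  (forall l, continuous g l) -> is_RInt g a c (RInt g a c).
Proof.
intros Hg; apply (RInt_correct (V := R_CompleteNormedModule)).
apply (ex_RInt_continuous (V := R_CompleteNormedModule)); intros; apply Hg.
Qed.

Lemma is_derive_primitive (g : R -> R) (a c : R) :
  (forall l, continuous g l) -> is_derive (RInt g a) c (g c).
Proof.
intros Hg; apply (is_derive_RInt g _ a); [|easy].
now apply filter_forall; intros; apply continuous_is_RInt.
Qed.

Lemma RInt_primitive (g : R -> R) (a c : R) :
  (forall l, continuous g l) -> RInt g a c = RInt g 0 c - RInt g 0 a.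
Proof.
intros Hg.
assert (H : RInt g 0 a + RInt g a c = RInt g 0 c)
  by (apply (RInt_Chasles g); eexists; now apply continuous_is_RInt).
lra.
Qed.

Definition double_RInt (tau : R) : R :=
  RInt (fun s => RInt b2 s tau) (tau - T) tau.

Lemma primitive_continuous (l : R) : continuous (RInt b2 0) l.
Proof.
apply (ex_derive_continuous (RInt b2 0)); eexists; now apply is_derive_primitive.
Qed.

(** With F the primitive of [b2], the inner integral is [F tau - F s]. Integrating in [s] moves
    [tau] out of the integrand, so the derivative follows from the fundamental theorem of calculus
    alone. *)
Lemma double_RInt_eq (tau : R) :
  double_RInt tau = T * RInt b2 0 tau
    - (RInt (RInt b2 0) 0 tau - RInt (RInt b2 0) 0 (tau - T)).
Proof.
unfold double_RInt; apply is_RInt_unique.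
apply (is_RInt_ext (fun s => minus (RInt b2 0 tau) (RInt b2 0 s))).
{ intros s _; symmetry; now apply RInt_primitive. }
rewrite <- (RInt_primitive (RInt b2 0) (tau - T)) by apply primitive_continuous.
apply (is_RInt_minus (V := R_NormedModule)).
- replace (T * RInt b2 0 tau) with (scal (tau - (tau - T)) (RInt b2 0 tau))
    by (unfold scal; simpl; unfold mult; simpl; ring).
  apply (is_RInt_const (V := R_NormedModule)).
- apply continuous_is_RInt, primitive_continuous.
Qed.

Lemma is_derive_double_RInt (tau : R) :
  is_derive double_RInt tau (T * b2 tau - RInt b2 (tau - T) tau).
Proof.
apply (is_derive_ext (fun tau => T * RInt b2 0 tau
    - (RInt (RInt b2 0) 0 tau - RInt (RInt b2 0) 0 (tau - T)))).
{ intros; now rewrite double_RInt_eq. }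
assert (H1 := is_derive_primitive b2 0 tau b2_continuous).
assert (H2 := fun l => is_derive_primitive (RInt b2 0) 0 l primitive_continuous).
assert (H3 := H2 tau); assert (H4 := H2 (tau - T)).
rewrite (RInt_primitive b2 (tau - T)) by apply b2_continuous.
evar_last.
- apply (is_derive_minus (K := R_AbsRing) (V := R_NormedModule)).
  + apply is_derive_scal, H1.
  + apply (is_derive_minus (K := R_AbsRing) (V := R_NormedModule)); [apply H3|].
    apply (is_derive_comp (V := R_NormedModule) (RInt (RInt b2 0) 0) (fun t => t - T));
      [apply H4|auto_derive; easy].
- unfold minus, plus, opp, scal; simpl; unfold mult; simpl; ring.
Qed.

Lemma double_RInt_bound (tau : R) : Rabs (double_RInt tau) <= T * (T * B).
Proof.
assert (HB : 0 <= B) by (apply Rle_trans with (2 := b2_bound 0), Rabs_pos).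
replace (T * (T * B)) with ((tau - (tau - T)) * (T * B)) by ring.
apply (norm_RInt_le_const (V := R_NormedModule) (fun s => RInt b2 s tau)); [lra| |].
- intros s Hs.
  apply Rle_trans with ((tau - s) * B); [|apply Rmult_le_compat_r; lra].
  apply (norm_RInt_le_const (V := R_NormedModule) b2); [lra| |].
  + intros; apply b2_bound.
  + now apply continuous_is_RInt.
- apply (continuous_is_RInt (fun s => RInt b2 s tau)); intros l.
  apply (continuous_ext (fun s => RInt b2 0 tau - RInt b2 0 s)).
  { intros s; symmetry; now apply RInt_primitive. }
  apply (continuous_minus (K := R_AbsRing) (V := R_NormedModule));
    [apply continuous_const|apply primitive_continuous].
Qed.

Definition weight (t : R) : R := exp (5 * alpha / T * double_RInt (t / alpha)).

(** The factor [alpha] in the exponent cancels the [/ alpha] of the chain rule; this is why the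
    decay rate will not depend on [alpha]. *)
Definition weight' (t : R) : R :=
  weight t * (5 / T * (T * b2 (t / alpha) - RInt b2 (t / alpha - T) (t / alpha))).

Lemma is_derive_weight (t : R) : is_derive weight t (weight' t).
Proof.
assert (H := is_derive_double_RInt (t / alpha)).
unfold weight', weight; evar_last.
- apply (is_derive_comp (V := R_NormedModule) exp); [apply is_derive_exp|].
  apply is_derive_scal.
  apply (is_derive_comp (V := R_NormedModule) double_RInt (fun t => t / alpha));
    [exact H|].
  auto_derive; [easy|reflexivity].
- unfold scal; simpl; unfold mult; simpl; field; lra.
Qed.

Lemma weight_continuous (t : R) : continuous weight t.
Proof. apply (ex_derive_continuous weight); eexists; apply is_derive_weight. Qed.

Lemma weight'_continuous (t : R) : continuous weight' t.
Proof.
assert (Hd : continuous (fun t => t / alpha) t)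
  by (apply (ex_derive_continuous (fun t => t / alpha)); auto_derive; easy).
assert (HdT : continuous (fun t => t / alpha - T) t)
  by (apply (ex_derive_continuous (fun t => t / alpha - T)); auto_derive; easy).
apply (continuous_mult (K := R_AbsRing)); [apply weight_continuous|].
apply (continuous_mult (K := R_AbsRing)); [apply continuous_const|].
apply (continuous_minus (K := R_AbsRing) (V := R_NormedModule)).
- apply (continuous_mult (K := R_AbsRing)); [apply continuous_const|].
  now apply (continuous_comp (fun t => t / alpha) b2).
- apply (continuous_ext (fun t => RInt b2 0 (t / alpha) - RInt b2 0 (t / alpha - T))).
  { intros s; symmetry; now apply RInt_primitive. }
  apply (continuous_minus (K := R_AbsRing) (V := R_NormedModule)).
  + apply (continuous_comp (fun t => t / alpha) (RInt b2 0)); [easy|].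
    apply primitive_continuous.
  + apply (continuous_comp (fun t => t / alpha - T) (RInt b2 0)); [easy|].
    apply primitive_continuous.
Qed.

Lemma weight_bounds (t : R) :
  exp (- (5 * alpha * T * B)) <= weight t <= exp (5 * alpha * T * B).
Proof.
assert (H := double_RInt_bound (t / alpha)); apply Rabs_le_between in H.
assert (Hk : 0 < 5 * alpha / T) by (apply Rdiv_lt_0_compat; lra).
assert (E : 5 * alpha / T * (T * (T * B)) = 5 * alpha * T * B) by (field; lra).
unfold weight; split; apply exp_le_mono; nra.
Qed.

End Weight.

(** * Decay and existence of trajectories *)

Lemma norm_R2_le (x : R2) : norm x <= Rabs (fst x) + Rabs (snd x).
Proof.
assert (H1 := Rabs_pos (fst x)); assert (H2 := Rabs_pos (snd x)).
apply Rsqr_incr_0_var; [|lra].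
rewrite !Rsqr_pow2, norm_R2_sqr, <- (pow2_abs (fst x)), <- (pow2_abs (snd x)); nra.
Qed.

Lemma continuous_pair {T U V : UniformSpace} (f : T -> U) (g : T -> V) (x : T) :
  continuous f x -> continuous g x -> continuous (fun y => (f y, g y)) x.
Proof.
intros Hf Hg; apply filterlim_locally; intros eps.
exact (filter_and (F := locally x) _ _ (proj1 (filterlim_locally _ _) Hf eps)
  (proj1 (filterlim_locally _ _) Hg eps)).
Qed.

Lemma lipschitz_continuous {U V : NormedModule R_AbsRing} (f : U -> V) (x : U) :
  lipschitz f -> continuous f x.
Proof.
intros [L HL]; apply (filterlim_locally_ball_norm (U := V)); intros eps.
(* [lipschitz] does not fix the sign of its constant, so a positive one is chosen. *)
assert (HL1 : 0 < Rabs L + 1) by (generalize (Rabs_pos L); lra).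
assert (Hd : 0 < eps / (Rabs L + 1)) by (apply Rdiv_lt_0_compat; [apply eps|easy]).
generalize (locally_ball_norm x (mkposreal _ Hd)).
apply filter_imp; intros y Hy; unfold ball_norm in *; simpl in Hy.
apply Rle_lt_trans with (1 := HL y x).
apply Rle_lt_trans with ((Rabs L + 1) * norm (minus y x)).
- apply Rmult_le_compat_r; [apply norm_ge_0|generalize (Rle_abs L); lra].
- apply Rlt_div_r in Hy; lra.
Qed.

(** The left side is a factor in [0, 1] that can be absorbed into [m]; the right side is the
    truncation of [v] to [-r, r], visibly bounded and Lipschitz with constant 1. Both views of the
    same term are used in [P_existence]. *)
Lemma cutoff_eq (r v : R) : 0 < r ->
  r / Rmax r (Rabs v) * v = Rmax (- r) (Rmin r v).
Proof.
intros Hr; destruct (Rle_or_lt (Rabs v) r) as [Hv|Hv].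
- rewrite (Rmax_left r) by exact Hv; apply Rabs_le_between in Hv.
  rewrite Rmin_right, Rmax_right by lra; field; lra.
- rewrite (Rmax_right r) by lra.
  revert Hv; unfold Rabs; destruct (Rcase_abs v); intros Hv.
  + rewrite Rmin_right, Rmax_left by lra; field; lra.
  + rewrite Rmin_left, Rmax_right by lra; field; lra.
Qed.

Lemma cutoff_lipschitz (r u v : R) : 0 < r ->
  Rabs (Rmax (- r) (Rmin r u) - Rmax (- r) (Rmin r v)) <= Rabs (u - v).
Proof.
intros Hr; unfold Rmin, Rmax.
destruct (Rle_dec r u), (Rle_dec r v);
repeat match goal with |- context [Rle_dec ?a ?b] => destruct (Rle_dec a b) end;
  apply Rabs_le; unfold Rabs; destruct (Rcase_abs (u - v)); lra.
Qed.

Lemma cutoff_bound (r v : R) : 0 < r -> Rabs (Rmax (- r) (Rmin r v)) <= r.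
Proof.
intros Hr; apply Rabs_le; unfold Rmin, Rmax.
destruct (Rle_dec r v);
repeat match goal with |- context [Rle_dec ?a ?b] => destruct (Rle_dec a b) end; lra.
Qed.

(** * Estimates along system (P), global existence and UGAS *)

Section SystemP.

Variables (b2 : R -> R) (T cb alpha B : R).
Hypothesis b2_neg : forall l, b2 l <= 0.
Hypothesis b2_continuous : forall l, continuous b2 l.
Hypothesis b2_bound : forall l, Rabs (b2 l) <= B.
Hypothesis T_gt0 : 0 < T.
Hypothesis cb_gt0 : 0 < cb.
Hypothesis alpha_gt0 : 0 < alpha.
Hypothesis b2_excitation : forall t, T + 5 * RInt b2 (t - T) t >= cb.

Let w := weight b2 T alpha.
Let w' := weight' b2 T alpha.
(** Bound on the absolute value of the logarithm of the weight. *)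
Let kappa := 5 * alpha * T * B.

Lemma w_gt0 (t : R) : 0 < w t.
Proof. apply exp_pos. Qed.

Lemma V_sharp_decrease (m : R2 -> R -> R) (x : R2) (t : R) :
  0 <= m x t <= 1 ->
  w' t * Q x + (w t * (2 * fst x + snd x) * fst (system_P m b2 alpha x t)
    + w t * (2 * snd x + fst x) * snd (system_P m b2 alpha x t))
  <= - (cb / T) * (w t * Q x).
Proof.
intros Hm.
assert (HQ := Q_derivative_bound x (b2 (t / alpha)) (m x t) (b2_neg _) Hm).
unfold system_P; simpl fst at 3; simpl snd at 3.
set (D := _ + _) in HQ.
replace (w t * _ * _ + _) with (w t * D) by (unfold D; simpl; ring).
assert (Hw := w_gt0 t); assert (HQ0 := Q_ge0 x).
apply Rmult_le_compat_l with (r := w t) in HQ; [|lra].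
(* The excitation hypothesis at time [t / alpha], divided by [T]. *)
assert (HI : 1 + 5 / T * RInt b2 (t / alpha - T) (t / alpha) >= cb / T).
{ apply Rle_ge, (Rmult_le_reg_l T); [easy|].
  replace (T * (cb / T)) with cb by (field; lra).
  replace (T * _) with (T + 5 * RInt b2 (t / alpha - T) (t / alpha))
    by (field; lra).
  now apply Rge_le. }
unfold w', weight'; fold w.
set (I := RInt b2 _ _) in *; set (b := b2 _) in *.
replace (5 / T * (T * b - I)) with (5 * b - 5 / T * I) by (field; lra).
assert (0 <= w t * Q x) by (apply Rmult_le_pos; lra).
assert (0 <= (1 + 5 / T * I - cb / T) * (w t * Q x)) by (apply Rmult_le_pos; lra).
lra.
Qed.

Lemma V_sharp_Lyapunov (m : R2 -> R -> R) :
  (forall x t, 0 <= m x t <= 1) ->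
  is_Lyapunov_function (system_P m b2 alpha) (V_sharp b2 T alpha).
Proof.
intros Hm; split.
{ intros x t _; apply Rmult_le_pos; [apply Rlt_le, w_gt0|apply Q_ge0]. }
exists (fun x t => w t * (2 * fst x + snd x)),
  (fun x t => w t * (2 * snd x + fst x)), (fun x t => w' t * Q x).
assert (Hfst : forall p : R2 * R, continuous (fun p => fst (fst p)) p).
{ intros [[x1 x2] t]; apply continuous_comp; apply continuous_fst. }
assert (Hsnd : forall p : R2 * R, continuous (fun p => snd (fst p)) p).
{ intros [[x1 x2] t]; apply continuous_comp;
    [apply continuous_fst|apply continuous_snd]. }
assert (Hcomp : forall (g : R -> R), (forall t, continuous g t) ->
  forall p : R2 * R, continuous (fun p => g (snd p)) p).
{ intros g Hg [x t]; apply continuous_comp; [apply continuous_snd|apply Hg]. }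
assert (Hw := fun t => weight_continuous b2 T alpha b2_continuous T_gt0 alpha_gt0 t).
assert (Hw' := fun t => weight'_continuous b2 T alpha b2_continuous T_gt0 alpha_gt0 t).
split; [split; [|split; [|split]]|].
- intros x1 x2 t Ht; split; [|split].
  + change (is_derive (fun y => w t * Q (y, x2)) x1 (w t * (2 * x1 + x2))).
    unfold Q; simpl; auto_derive; [easy|ring].
  + change (is_derive (fun y => w t * Q (x1, y)) x2 (w t * (2 * x2 + x1))).
    unfold Q; simpl; auto_derive; [easy|ring].
  + apply is_derive_within_of_derive; [exact Ht|].
    assert (Hd := is_derive_weight b2 T alpha b2_continuous T_gt0 alpha_gt0 t).
    change (is_derive (fun s => w s * Q (x1, x2)) t (w' t * Q (x1, x2))).
    apply (is_derive_ext (fun s => Q (x1, x2) * w s)); [intros; apply Rmult_comm|].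
    rewrite Rmult_comm; apply is_derive_scal, Hd.
- apply continuous_on_forall; intros p _.
  apply (continuous_ext (fun p => w (snd p) * (2 * fst (fst p) + snd (fst p))));
    [now intros []|].
  apply (continuous_mult (K := R_AbsRing)); [now apply Hcomp|].
  apply (continuous_plus (K := R_AbsRing) (V := R_NormedModule)); [|apply Hsnd].
  apply (continuous_mult (K := R_AbsRing)); [apply continuous_const|apply Hfst].
- apply continuous_on_forall; intros p _.
  apply (continuous_ext (fun p => w (snd p) * (2 * snd (fst p) + fst (fst p))));
    [now intros []|].
  apply (continuous_mult (K := R_AbsRing)); [now apply Hcomp|].
  apply (continuous_plus (K := R_AbsRing) (V := R_NormedModule)); [|apply Hfst].
  apply (continuous_mult (K := R_AbsRing)); [apply continuous_const|apply Hsnd].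
- apply continuous_on_forall; intros p _.
  apply (continuous_ext (fun p => w' (snd p) * (fst (fst p) * fst (fst p)
    + snd (fst p) * snd (fst p) + fst (fst p) * snd (fst p)))).
  { intros [x t]; unfold uncurry, Q; simpl; ring. }
  apply (continuous_mult (K := R_AbsRing)); [now apply Hcomp|].
  apply (continuous_plus (K := R_AbsRing) (V := R_NormedModule));
    [apply (continuous_plus (K := R_AbsRing) (V := R_NormedModule))|];
    apply (continuous_mult (K := R_AbsRing)); first [apply Hfst|apply Hsnd].
- assert (He : forall k, 0 < exp k) by (intros; apply exp_pos).
  (* The bounds [exp (- kappa)] and [exp kappa] of the weight times the bounds 1/2 and 3/2 of [Q];
     the third function is the decay rate [cb / T] times the first. *)
  exists (fun r => exp (- kappa) / 2 * r ^ 2), (fun r => 3 / 2 * exp kappa * r ^ 2),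
    (fun r => cb / T * (exp (- kappa) / 2) * r ^ 2).
  assert (H0 : 0 < exp (- kappa) / 2) by (specialize (He (- kappa)); lra).
  assert (Hc : 0 < cb / T) by (apply Rdiv_lt_0_compat; lra).
  split; [now apply class_Kinf_scal_pow2|].
  split; [apply class_Kinf_scal_pow2; specialize (He kappa); lra|].
  split; [now apply class_Kinf_positive_definite, class_Kinf_scal_pow2, Rmult_lt_0_compat|].
  intros x t _; cbv beta.
  change (V_sharp b2 T alpha x t) with (w t * Q x).
  assert (Hb := weight_bounds b2 T alpha B b2_continuous b2_bound T_gt0 alpha_gt0 t).
  fold kappa in Hb; fold w in Hb.
  assert (HQ := Q_bounds x); assert (HQ0 := Q_ge0 x).
  assert (Hn := pow2_ge_0 (norm x)).
  assert (Hl : exp (- kappa) / 2 * norm x ^ 2 <= w t * Q x).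
  { replace (_ / 2 * _) with (exp (- kappa) * (norm x ^ 2 / 2)) by field.
    apply Rmult_le_compat; try lra; apply Rlt_le, He. }
  split; [split; [exact Hl|]|].
  + replace (3 / 2 * _ * _) with (exp kappa * (3 / 2 * norm x ^ 2)) by ring.
    apply Rmult_le_compat; try lra; apply Rlt_le, w_gt0.
  + apply Rle_trans with (1 := V_sharp_decrease m x t (Hm x t)).
    assert (H1 := Rmult_le_compat_l _ _ _ (Rlt_le _ _ Hc) Hl); lra.
Qed.

(** Comparing norms through [w * Q] gives the factor [3 * exp (2 * kappa)] for squared norms; 3 is
    rounded up to 4, whose square root is 2. Passing from squared norms to norms also halves the
    rate [cb / T], which gives [c]. *)
Let K := 2 * exp kappa.
Let c := cb / T / 2.

(** Multiplied by the integrating factor [exp (2 * c * s)], the Lyapunov function is nonincreasing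
    along the trajectory, by the mean value theorem on [t0, t]. Only the range of [m] enters, so the
    bound also serves the cut-off system. *)
Lemma trajectory_decay (m : R2 -> R -> R) (t0 : R) (x0 : R2) (t1 : Rbar)
    (phi : R -> R2) :
  (forall x t, 0 <= m x t <= 1) ->
  is_trajectory (system_P m b2 alpha) t0 x0 t1 phi ->
  forall t, t0 <= t -> Rbar_lt t t1 ->
    norm (phi t) <= K * norm x0 * exp (- c * (t - t0)).
Proof.
intros Hm Hphi t Ht Ht1.
assert (Hbelow : forall s, s <= t -> Rbar_lt s t1)
  by (intros s Hs; apply Rbar_le_lt_trans with t; easy).
set (psi := fun s => phi (Rmax t0 s)).
set (u := fun s => fst (psi s)); set (v := fun s => snd (psi s)).
set (g := fun s => exp (2 * c * s) * (w s * (u s ^ 2 + v s ^ 2 + u s * v s))).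
set (h := system_P m b2 alpha) in *.
set (dg := fun s => exp (2 * c * s) * (2 * c * (w s * Q (psi s))
  + (w' s * Q (psi s) + (w s * (2 * u s + v s) * fst (h (psi s) s)
      + w s * (2 * v s + u s) * snd (h (psi s) s))))).
assert (Hg : g t <= g t0).
{ destruct (MVT_gen g t0 t dg) as [s [_ Es]].
  - rewrite Rmin_left, Rmax_right by assumption; intros s [Hs1 Hs2].
    destruct (trajectory_is_derive _ _ _ _ _ Hphi s Hs1 (Hbelow s (Rlt_le _ _ Hs2)))
      as [Hu Hv].
    assert (Hloc : locally s (fun r => phi r = psi r)).
    { generalize (open_gt t0 s Hs1); apply filter_imp; intros r Hr.
      unfold psi; rewrite Rmax_right; [easy|now apply Rlt_le]. }
    assert (Es := locally_singleton _ _ Hloc).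
    rewrite Es in Hu, Hv.
    assert (Hu' : is_derive u s (fst (h (psi s) s))).
    { apply is_derive_ext_loc with (2 := Hu).
      generalize Hloc; apply filter_imp; intros r Hr; unfold u; now rewrite Hr. }
    assert (Hv' : is_derive v s (snd (h (psi s) s))).
    { apply is_derive_ext_loc with (2 := Hv).
      generalize Hloc; apply filter_imp; intros r Hr; unfold v; now rewrite Hr. }
    assert (Hw := is_derive_weight b2 T alpha b2_continuous T_gt0 alpha_gt0 s).
    fold w in Hw; change (weight' b2 T alpha s) with (w' s) in Hw.
    unfold g; auto_derive.
    + repeat split; eexists; eassumption.
    + replace (Derive (fun r => w r) s) with (w' s) by (symmetry; now apply is_derive_unique).
      replace (Derive (fun r => u r) s) with (fst (h (psi s) s))
        by (symmetry; now apply is_derive_unique).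
      replace (Derive (fun r => v r) s) with (snd (h (psi s) s))
        by (symmetry; now apply is_derive_unique).
      unfold dg, Q; fold (u s) (v s); ring.
  - rewrite Rmin_left, Rmax_right by assumption; intros s [Hs1 Hs2].
    apply continuity_pt_filterlim.
    assert (Hpsi := trajectory_continuous _ _ _ _ _ Hphi s Hs1 (Hbelow s Hs2)).
    fold psi in Hpsi.
    assert (Hu : continuous u s)
      by (apply (continuous_comp psi fst); [exact Hpsi|destruct (psi s); apply continuous_fst]).
    assert (Hv : continuous v s)
      by (apply (continuous_comp psi snd); [exact Hpsi|destruct (psi s); apply continuous_snd]).
    change (continuous g s).
    apply (continuous_mult (K := R_AbsRing)).
    { apply (ex_derive_continuous (fun s => exp (2 * c * s))); auto_derive; easy. }
    apply (continuous_mult (K := R_AbsRing)); [now apply weight_continuous|].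
    apply (continuous_ext (fun s => u s * u s + v s * v s + u s * v s)).
    { intros r; change (u r * u r + v r * v r + u r * v r
        = u r ^ 2 + v r ^ 2 + u r * v r); ring. }
    apply (continuous_plus (K := R_AbsRing) (V := R_NormedModule));
      [apply (continuous_plus (K := R_AbsRing) (V := R_NormedModule))|];
      now apply (continuous_mult (K := R_AbsRing)).
  - assert (Hd : dg s <= 0).
    { assert (H := V_sharp_decrease m (psi s) s (Hm _ _)).
      fold h (u s) (v s) in H; unfold dg.
      assert (He := exp_pos (2 * c * s)).
      replace (cb / T) with (2 * c) in H by (unfold c; field; lra).
      set (X := _ + (_ + _)) in H; fold X; nra. }
    nra. }
assert (Hpt : psi t = phi t) by (unfold psi; now rewrite Rmax_right).
assert (Hp0 : psi t0 = x0)
  by (unfold psi; rewrite Rmax_left by lra; apply Hphi).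
change (exp (2 * c * t) * (w t * Q (psi t)) <= exp (2 * c * t0) * (w t0 * Q (psi t0))) in Hg.
rewrite Hpt, Hp0 in Hg.
set (e := exp (- c * (t - t0))).
assert (He : 0 < e) by apply exp_pos.
assert (Hk : 0 < exp kappa) by apply exp_pos.
assert (Hn0 := norm_ge_0 x0).
apply Rsqr_incr_0_var; [|unfold K; apply Rmult_le_pos; [apply Rmult_le_pos|]; lra].
rewrite !Rsqr_pow2.
assert (Hwt := proj1 (weight_bounds b2 T alpha B b2_continuous b2_bound T_gt0 alpha_gt0 t)).
assert (Hw0 := proj2 (weight_bounds b2 T alpha B b2_continuous b2_bound T_gt0 alpha_gt0 t0)).
fold kappa w in Hwt, Hw0.
assert (HQt := proj1 (Q_bounds (phi t))); assert (HQ0 := proj2 (Q_bounds x0)).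
assert (Hg' : w t * Q (phi t) <= e ^ 2 * (w t0 * Q x0)).
{ apply (Rmult_le_reg_l (exp (2 * c * t))); [apply exp_pos|].
  apply Rle_trans with (1 := Hg); right.
  replace (exp (2 * c * t0)) with (exp (2 * c * t) * e ^ 2); [ring|].
  unfold e; simpl pow; rewrite Rmult_1_r, <- !exp_plus; f_equal; ring. }
assert (Hl : exp (- kappa) * (norm (phi t) ^ 2 / 2) <= w t * Q (phi t)).
{ apply Rmult_le_compat; try assumption; [apply Rlt_le, exp_pos|].
  generalize (pow2_ge_0 (norm (phi t))); lra. }
assert (Hr : w t0 * Q x0 <= exp kappa * (3 / 2 * norm x0 ^ 2)).
{ apply Rmult_le_compat; try assumption; [apply Rlt_le, w_gt0|apply Q_ge0]. }
assert (He2 : 0 <= e ^ 2) by apply pow2_ge_0.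
assert (Hr' := Rmult_le_compat_l _ _ _ He2 Hr).
assert (Hmul : norm (phi t) ^ 2 / 2 <= exp kappa * (e ^ 2 * (exp kappa * (3 / 2 * norm x0 ^ 2)))).
{ replace (norm (phi t) ^ 2 / 2) with (exp kappa * (exp (- kappa) * (norm (phi t) ^ 2 / 2))).
  2: { rewrite <- Rmult_assoc, <- exp_plus, Rplus_opp_r, exp_0; ring. }
  apply Rmult_le_compat_l; lra. }
replace ((K * norm x0 * e) ^ 2) with (4 * (exp kappa * (e ^ 2 * (exp kappa * (norm x0 ^ 2)))))
  by (unfold K; ring).
assert (0 <= exp kappa * (e ^ 2 * (exp kappa * (norm x0 ^ 2)))).
{ repeat apply Rmult_le_pos; try lra; apply pow2_ge_0. }
lra.
Qed.


(* Multiplying [m] by [r / max r |x2|] keeps it in [0, 1], so the decay estimate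
   still applies, and makes the field globally Lipschitz; for [r] larger than the
   a priori bound of the trajectory the factor is 1 along it. *)
Lemma P_existence (m : R2 -> R -> R) (x0 : R2) (t0 : R) :
  (forall x t, 0 <= m x t <= 1) ->
  lipschitz (fun p : R2 * R => m (fst p) (snd p)) ->
  exists phi, is_trajectory (system_P m b2 alpha) t0 x0 p_infty phi.
Proof.
intros Hm Hlip.
assert (Hk : 0 < K) by (assert (H := exp_pos kappa); unfold K; lra).
assert (Hn0 := norm_ge_0 x0).
(* [K] does not depend on [m], so [r] can be fixed before the modified system whose trajectory it
   has to bound. The summand 1 keeps [r] positive when [x0] is zero. *)
set (r := K * norm x0 + 1).
assert (Hr : 0 < r) by (assert (0 <= K * norm x0) by (apply Rmult_le_pos; lra); unfold r; lra).
set (mr := fun x t => m x t * (r / Rmax r (Rabs (snd x)))).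
assert (Hmr : forall x t, 0 <= mr x t <= 1).
{ intros x t; specialize (Hm x t).
  assert (H1 := Rmax_l r (Rabs (snd x))); unfold mr; set (q := Rmax _ _) in *.
  assert (H2 : 0 <= r / q <= 1).
  { split; [apply Rlt_le, Rdiv_lt_0_compat; lra|].
    apply Rle_div_l; lra. }
  nra. }
assert (Hsnd : forall x t, snd (system_P mr b2 alpha x t) =
  - fst x - snd x - b2 (t / alpha) * (m x t * Rmax (- r) (Rmin r (snd x)))).
{ intros x t; rewrite <- cutoff_eq by exact Hr; unfold mr; simpl; ring. }
assert (HB : 0 <= B) by (apply Rle_trans with (2 := b2_bound 0), Rabs_pos).
assert (Hmc : forall p : R2 * R, continuous (fun p => m (fst p) (snd p)) p)
  by (intros p; exact (lipschitz_continuous _ p Hlip)).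
destruct Hlip as [L0 HL0].
set (L := Rabs L0); assert (HL : 0 <= L) by apply Rabs_pos.
assert (Hmlip : forall x y t, Rabs (m x t - m y t) <= L * norm_dist x y).
{ intros x y t; assert (H := HL0 (x, t) (y, t)).
  change (Rabs (m x t - m y t)
    <= L0 * sqrt (norm_dist x y ^ 2 + Rabs (t - t) ^ 2)) in H.
  rewrite Rminus_diag, Rabs_R0, pow_i, Rplus_0_r, sqrt_pow2 in H
    by (lia || apply norm_ge_0).
  apply Rle_trans with (1 := H), Rmult_le_compat_r;
    [apply norm_ge_0|apply Rle_abs]. }
(* In the Lipschitz constant, 3 comes from the linear terms [x2], [- x1] and [- x2], and
   [B * (1 + r * L)] from the damping term with [b2]. The other constant bounds the field at [x0]
   for all times. *)
destruct (picard_existence (V := prod_CompleteNormedModule R_AbsRing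
    R_CompleteNormedModule R_CompleteNormedModule)
  (system_P mr b2 alpha) (3 + B * (1 + r * L))
  (Rabs (snd x0) + (Rabs (fst x0) + Rabs (snd x0) + B * r)) x0 t0)
  as (phi & Hphi0 & Hphi).
- assert (0 <= B * (1 + r * L)); [|lra].
  apply Rmult_le_pos; [easy|]; assert (0 <= r * L) by (apply Rmult_le_pos; lra); lra.
- enough (H : forall (x y : R2) t,
    norm_dist (system_P mr b2 alpha x t) (system_P mr b2 alpha y t)
    <= (3 + B * (1 + r * L)) * norm_dist x y) by exact H.
  intros x y t; apply Rle_trans with (1 := norm_R2_le _).
  change (Rabs (snd x - snd y)
    + Rabs (snd (system_P mr b2 alpha x t) - snd (system_P mr b2 alpha y t))
    <= (3 + B * (1 + r * L)) * norm_dist x y).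
  rewrite !Hsnd.
  assert (H1 : Rabs (fst x - fst y) <= norm_dist x y)
    by apply (norm_le_prod_norm_1 (minus x y)).
  assert (H2 : Rabs (snd x - snd y) <= norm_dist x y)
    by apply (norm_le_prod_norm_2 (minus x y)).
  specialize (Hmlip x y t); set (N := norm_dist x y) in *.
  assert (H3 := cutoff_lipschitz r (snd x) (snd y) Hr).
  assert (H4 := cutoff_bound r (snd y) Hr).
  set (Cx := Rmax (- r) (Rmin r (snd x))) in *.
  set (Cy := Rmax (- r) (Rmin r (snd y))) in *.
  assert (H5 : Rabs (m x t * Cx - m y t * Cy) <= (1 + r * L) * N).
  (* Here the cut-off pays: the variation of [m] is multiplied by [Cy], bounded by [r], instead of
     the unbounded [snd y]. *)
  { replace (_ - _) with (m x t * (Cx - Cy) + (m x t - m y t) * Cy) by ring.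
    apply Rle_trans with (1 := Rabs_triang _ _); rewrite !Rabs_mult.
    rewrite (Rabs_pos_eq (m x t)) by apply Hm.
    assert (Hmx := Hm x t).
    assert (Ha := Rabs_pos (Cx - Cy)); assert (Hb := Rabs_pos (m x t - m y t)).
    assert (Hc := Rabs_pos Cy).
    assert (m x t * Rabs (Cx - Cy) <= 1 * N) by (apply Rmult_le_compat; lra).
    assert (Rabs (m x t - m y t) * Rabs Cy <= (L * N) * r)
      by (apply Rmult_le_compat; lra).
    lra. }
  assert (H6 : Rabs (b2 (t / alpha) * (m x t * Cx - m y t * Cy)) <= B * ((1 + r * L) * N)).
  { rewrite Rabs_mult; apply Rmult_le_compat; try apply Rabs_pos; [apply b2_bound|easy]. }
  replace (- fst x - snd x - _ - _) with (- (fst x - fst y) + (- (snd x - snd y)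
    + - (b2 (t / alpha) * (m x t * Cx - m y t * Cy)))) by ring.
  assert (H7 := Rabs_triang (- (fst x - fst y)) (- (snd x - snd y)
    + - (b2 (t / alpha) * (m x t * Cx - m y t * Cy)))).
  assert (H8 := Rabs_triang (- (snd x - snd y))
    (- (b2 (t / alpha) * (m x t * Cx - m y t * Cy)))).
  rewrite !Rabs_Ropp in H7; rewrite !Rabs_Ropp in H8; lra.
- enough (H : forall u : R -> R2, (forall t, continuous u t) ->
    forall t, continuous (fun s => system_P mr b2 alpha (u s) s) t) by exact H.
  intros u Hu t.
  assert (Hf : forall t, continuous (fun s => fst (u s)) t).
  { intros s; apply (continuous_comp u fst); [apply Hu|destruct (u s); apply continuous_fst]. }
  assert (Hs : forall t, continuous (fun s => snd (u s)) t).
  { intros s; apply (continuous_comp u snd); [apply Hu|destruct (u s); apply continuous_snd]. }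
  apply (continuous_pair (U := R_UniformSpace) (V := R_UniformSpace)
    (fun s => snd (u s)) (fun s => snd (system_P mr b2 alpha (u s) s))); [apply Hs|].
  apply (continuous_ext (fun s => - fst (u s) - snd (u s)
    - b2 (s / alpha) * (m (u s) s * Rmax (- r) (Rmin r (snd (u s)))))).
  { intros s; now rewrite Hsnd. }
  apply (continuous_minus (K := R_AbsRing) (V := R_NormedModule));
    [apply (continuous_minus (K := R_AbsRing) (V := R_NormedModule))|].
  + apply (continuous_opp (K := R_AbsRing) (V := R_NormedModule)), Hf.
  + apply Hs.
  + apply (continuous_mult (K := R_AbsRing)).
    { apply (continuous_comp (fun s => s / alpha) b2); [|easy].
      apply (ex_derive_continuous (fun s => s / alpha)); auto_derive; easy. }
    apply (continuous_mult (K := R_AbsRing)).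
    * apply (continuous_comp (fun s => (u s, s)) (fun p : R2 * R => m (fst p) (snd p))).
      { apply continuous_pair; [apply Hu|apply continuous_id]. }
      apply Hmc.
    * apply (continuous_comp (fun s => snd (u s)) (fun v => Rmax (- r) (Rmin r v)));
        [apply Hs|].
      apply (lipschitz_continuous (U := R_NormedModule) (V := R_NormedModule)).
      exists 1; intros a b; rewrite Rmult_1_l; now apply cutoff_lipschitz.
- intros t.
  apply Rle_trans with (1 := norm_R2_le (system_P mr b2 alpha x0 t)).
  rewrite Hsnd; simpl fst at 1; apply Rplus_le_compat_l.
  assert (H4 := cutoff_bound r (snd x0) Hr).
  set (Cx := Rmax (- r) (Rmin r (snd x0))) in *.
  assert (H5 : Rabs (b2 (t / alpha) * (m x0 t * Cx)) <= B * r).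
  { rewrite Rabs_mult; apply Rmult_le_compat; try apply Rabs_pos; [apply b2_bound|].
    rewrite Rabs_mult, (Rabs_pos_eq (m x0 t)) by apply Hm.
    assert (Hmx := Hm x0 t); assert (Hc := Rabs_pos Cx).
    rewrite <- (Rmult_1_l r); apply Rmult_le_compat; lra. }
  replace (_ - _ - _) with (- fst x0 + (- snd x0 + - (b2 (t / alpha) * (m x0 t * Cx))))
    by ring.
  assert (H7 := Rabs_triang (- fst x0)
    (- snd x0 + - (b2 (t / alpha) * (m x0 t * Cx)))).
  assert (H8 := Rabs_triang (- snd x0) (- (b2 (t / alpha) * (m x0 t * Cx)))).
  rewrite !Rabs_Ropp in H7; rewrite !Rabs_Ropp in H8; lra.
- assert (Htraj : is_trajectory (system_P mr b2 alpha) t0 x0 p_infty phi).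
  { split; [exact Hphi0|]; intros t [Ht _]; now apply Hphi. }
  exists phi; split; [exact Hphi0|]; intros t [Ht Ht1].
  assert (Hd := trajectory_decay mr t0 x0 p_infty phi Hmr Htraj t Ht Ht1).
  assert (Hv : Rabs (snd (phi t)) <= r).
  { apply Rle_trans with (norm (phi t)); [exact (norm_le_prod_norm_2 (phi t))|].
    apply Rle_trans with (1 := Hd).
    assert (He : exp (- c * (t - t0)) <= 1).
    { rewrite <- exp_0; apply exp_le_mono.
      assert (0 < c) by (unfold c; repeat apply Rdiv_lt_0_compat; lra); nra. }
    assert (0 <= K * norm x0) by (apply Rmult_le_pos; lra).
    unfold r; nra. }
  replace (system_P m b2 alpha (phi t) t) with (system_P mr b2 alpha (phi t) t).
  + now apply Htraj.
  + unfold system_P, mr; rewrite Rmax_left by exact Hv.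
    now replace (r / r) with 1 by (field; lra); rewrite Rmult_1_r.
Qed.

Lemma P_UGAS (m : R2 -> R -> R) :
  (forall x t, 0 <= m x t <= 1) ->
  lipschitz (fun p : R2 * R => m (fst p) (snd p)) ->
  UGAS (system_P m b2 alpha).
Proof.
intros Hm Hlip; exists (fun s t => K * s * exp (- c * t)); split.
- apply class_KL_exp; [|unfold c; repeat apply Rdiv_lt_0_compat; lra].
  assert (H := exp_pos kappa); unfold K; lra.
- intros x0 t0 _; split; [now apply P_existence|].
  intros t1 phi Hphi t; now apply (trajectory_decay m).
Qed.

End SystemP.

Theorem theorem15 (m : R2 -> R -> R) (b2 : R -> R) (T cb : R)
  (hm01 : forall x t, 0 <= m x t <= 1)
  (hmLip : lipschitz (fun p : R2 * R => m (fst p) (snd p)))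
  (hb2neg : forall l, b2 l <= 0)
  (hb2bdd : bounded_fun b2)
  (hb2diff : forall l, ex_derive b2 l)
  (hb2C1 : forall l, continuous (Derive b2) l)
  (hb2'bdd : bounded_fun (Derive b2))
  (hT : 0 < T) (hcb : 0 < cb)
  (hPE : forall t, T + 5 * RInt b2 (t - T) t >= cb) :
  forall alpha : R, 0 < alpha ->
    is_Lyapunov_function (system_P m b2 alpha) (V_sharp b2 T alpha) /\
    UGAS (system_P m b2 alpha).
Proof.
intros alpha Halpha; destruct hb2bdd as [B HB].
assert (Hc : forall l, continuous b2 l)
  by (intros l; now apply (ex_derive_continuous b2)).
split.
- now apply (V_sharp_Lyapunov b2 T cb alpha B).
- now apply (P_UGAS b2 T cb alpha B).
Qed.
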